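(* Let $\bm{A}=(a_{ij})\in\mathbb{R}_{+}^{n\times n}$ be a pairwise comparison matrix (i.e. $a_{ij}=1/a_{ji}>0$ for all $i,j$) with tropical spectral radius $\lambda$, and denote $\bm{A}_{\lambda}=\lambda^{-1}\bm{A}$ and $\bm{B}=\bm{A}_{\lambda}^{\ast}$, the Kleene star of $\bm{A}_{\lambda}$. Then all score vectors for $\bm{A}$, that is, all vectors $\bm{x}=(x_i)$ with positive entries that minimize $\max_{i,j}a_{ij}x_{j}/x_{i}$ over all positive vectors, are given by $$\bm{x}=\bm{B}\bm{u},\qquad \bm{u}\in\mathbb{R}_{+}^{n},\ \bm{u}\ne\bm{0},$$ where the product is the max-algebra matrix product; i.e. the set of score vectors equals $\{\bm{B}\bm{u}:\bm{u}\in\mathbb{R}_{+}^{n},\ \bm{u}\neq\bm{0}\}$.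
   Context: All algebra is in the max-algebra $\mathbb{R}_{\max}=(\mathbb{R}_{+},\oplus,\otimes,0,1)$, where $\mathbb{R}_{+}$ is the set of nonnegative reals, $x\oplus y=\max(x,y)$, and $\otimes$ is ordinary multiplication (sign omitted). Matrix and vector operations use the usual entrywise formulas with $\oplus,\otimes$ in place of $+,\times$; e.g. $(\bm{B}\bm{u})_i=\max_j b_{ij}u_j$. $\bm{0}$ is the zero vector, $\bm{I}$ the identity matrix ($1$ on the diagonal, $0$ elsewhere), and powers are iterated products with $\bm{A}^0=\bm{I}$. The tropical spectral radius of $\bm{A}\in\mathbb{R}_{+}^{n\times n}$ is $$\lambda=\max_{1\le k\le n}\ \max_{1\le i_1,\ldots,i_k\le n}(a_{i_1i_2}a_{i_2i_3}\cdots a_{i_ki_1})^{1/k}.$$ The Kleene star of $\bm{A}\in\mathbb{R}_{+}^{n\times n}$ is $\bm{A}^{\ast}=\bm{I}\oplus\bm{A}\oplus\cdots\oplus\bm{A}^{n-1}$. A pairwise comparison matrix is a square matrix with $a_{ij}=1/a_{ji}>0$ for all $i,j$ (so $a_{ii}=1$). Its score vectors are the positive vectors $\bm{x}$ minimizing $\max_{i,j}a_{ij}x_j/x_i$ (log-Chebyshev approximation of $\bm{A}$ by consistent matrices $(x_i/x_j)$). *)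

(* Defs.v *)
From mathcomp Require Import all_boot all_order all_algebra.
From mathcomp Require Import all_classical all_reals all_analysis.

Set Implicit Arguments.
Unset Strict Implicit.
Unset Printing Implicit Defensive.

Import Order.TTheory GRing.Theory Num.Theory.
Local Open Scope classical_set_scope.
Local Open Scope ring_scope.

(* Elements of the max-algebra R_max are
   represented by elements of R subject to nonnegativity hypotheses; 0 is the
   neutral element of max on nonnegative reals, hence the default value of
   every iterated maximum below. *)

Definition nonneg_mx (R : realType) (m n : nat) (A : 'M[R]_(m, n)) : Prop :=
  forall i j, 0 <= A i j.

Definition pos_mx (R : realType) (m n : nat) (A : 'M[R]_(m, n)) : Prop :=
  forall i j, 0 < A i j.

Definition trop_add (R : realType) (m n : nat) (A B : 'M[R]_(m, n)) :
    'M[R]_(m, n) :=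
  \matrix_(i, j) Num.max (A i j) (B i j).

Definition trop_mul (R : realType) (m n p : nat)
    (A : 'M[R]_(m, n)) (B : 'M[R]_(n, p)) : 'M[R]_(m, p) :=
  \matrix_(i, j) \big[Num.max/0]_(k < n) (A i k * B k j).

(* The max-algebra identity matrix has the same entries as the usual one. *)
Definition trop_exp (R : realType) (n : nat) (A : 'M[R]_n) (k : nat) :
    'M[R]_n :=
  iter k (trop_mul A) 1%:M.

Definition kleene_star (R : realType) (n : nat) (A : 'M[R]_n) : 'M[R]_n :=
  \big[@trop_add R n n/0]_(k < n) trop_exp A k.

(* [ordS] is the cyclic successor on 'I_k, so the product runs over the closed
   walk i_1 -> i_2 -> ... -> i_k -> i_1. *)
Definition trop_spectral_radius (R : realType) (n : nat) (A : 'M[R]_n) : R :=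
  \big[Num.max/0]_(1 <= k < n.+1)
    \big[Num.max/0]_(i : {ffun 'I_k -> 'I_n})
      (\prod_(l < k) A (i l) (i (ordS l))) `^ (k%:R^-1).

Definition pairwise_comparison (R : realType) (n : nat) (A : 'M[R]_n) : Prop :=
  forall i j, A i j = (A j i)^-1 /\ 0 < A i j.

Definition log_chebyshev_err (R : realType) (n : nat)
    (A : 'M[R]_n) (x : 'cV[R]_n) : R :=
  \big[Num.max/0]_(i < n) \big[Num.max/0]_(j < n) (A i j * x j 0 / x i 0).

Definition score_vectors (R : realType) (n : nat) (A : 'M[R]_n) :
    set 'cV[R]_n :=
  [set x | pos_mx x /\
           forall y : 'cV[R]_n, pos_mx y ->
             log_chebyshev_err A x <= log_chebyshev_err A y].

(* Main.v *)
(** A positive [x] has error at most [c] iff [c^-1 A x <= x]. Telescoping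
    [x_j / x_i] along closed walks shows that every error is at least the
    spectral radius [lambda]. Conversely, deleting a closed subwalk, whose
    normalized weight is at most 1, from a walk of length [n] gives
    [lambda^-1 A B <= B] for [B = (lambda^-1 A)^*], so that every [B u] has error
    at most [lambda]. Hence [lambda] is the minimum, and the score vectors are the
    positive solutions of [lambda^-1 A x <= x], for which [x = B x]. *)
Require Import Defs.
From mathcomp Require Import all_boot all_order all_algebra.
From mathcomp Require Import all_classical all_reals all_analysis.
Import Order.TTheory GRing.Theory Num.Theory.
Local Open Scope classical_set_scope.
Local Open Scope ring_scope.

(** * Walks and the removal of closed subwalks *)

Lemma nonuniq_loop {T : eqType} (x : T) (p : seq T) :
  ~~ uniq (x :: p) ->
  exists p1 p2 p3, [/\ p = p1 ++ p2 ++ p3, p2 != [::]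
                     & last (last x p1) p2 = last x p1].
Proof.
elim: p x => [//|y p IH] x.
(* Either the start recurs, which closes a loop at the front of the walk, or the repetition lies in
   the tail. *)
have [xyp _|xyp] := boolP (x \in y :: p).
  case/splitPr: xyp => p2 p3.
  exists [::], (rcons p2 x), p3; rewrite cat_rcons /= last_rcons.
  by split=> //; case: p2.
rewrite cons_uniq xyp => /IH[p1 [p2 [p3 [-> p2N0 lp]]]].
by exists (y :: p1), p2, p3.
Qed.

(** A walk is its start [i] and the list [p] of its later vertices: its length is [size p] and its
    end is [last i p]. *)
Fixpoint walk_weight {R : realType} {n : nat} (A : 'M[R]_n) (i : 'I_n)
    (p : seq 'I_n) : R :=
  if p is j :: q then A i j * walk_weight A j q else 1.

Lemma walk_weight_cat {R : realType} {n : nat} (A : 'M[R]_n) i p q :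
  walk_weight A i (p ++ q) = walk_weight A i p * walk_weight A (last i p) q.
Proof. by elim: p i => [|j p IH] i /=; rewrite ?mul1r// IH mulrA. Qed.

Lemma walk_weight_ge0 {R : realType} {n : nat} (A : 'M[R]_n) i p :
  nonneg_mx A -> 0 <= walk_weight A i p.
Proof. by move=> A0; elim: p i => [|j p IH] i //=; rewrite mulr_ge0. Qed.

Lemma walk_weightZ {R : realType} {n : nat} (A : 'M[R]_n) c i p :
  walk_weight (c *: A) i p = c ^+ size p * walk_weight A i p.
Proof.
by elim: p i => [|j p IH] i /=; rewrite ?mul1r// IH mxE exprS mulrACA.
Qed.

Lemma walk_weightE {R : realType} {n : nat} (A : 'M[R]_n) i p :
  walk_weight A i p =
  \prod_(l < size p) A (nth i (i :: p) l) (nth i (i :: p) l.+1).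
Proof.
elim: p i => [|j p IH] i /=; first by rewrite big_ord0.
rewrite big_ord_recl IH /=; congr (_ * _).
by apply: eq_bigr => l _; congr (A _ _); apply: set_nth_default => //=;
  rewrite ltnS ltnW.
Qed.

(** Lengths stop at [n], as do those over which the spectral radius is taken. *)
Definition cycles_le1 {R : realType} {n : nat} (A : 'M[R]_n) : Prop :=
  forall i p, (0 < size p <= n)%N -> last i p = i -> walk_weight A i p <= 1.

(** A walk of length [n] visits [n.+1] vertices, so one recurs. Cutting out the closed subwalk in
    between, of weight at most 1, cannot lower the weight. *)
Lemma walk_shorten {R : realType} {n : nat} (A : 'M[R]_n) i p :
  nonneg_mx A -> cycles_le1 A -> size p = n ->
  exists q, [/\ (size q < n)%N, last i q = last i p
              & walk_weight A i p <= walk_weight A i q].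
Proof.
move=> A0 cycA sp.
have : ~~ uniq (i :: p).
  apply/negP => /card_uniqP/= ip.
  by have := max_card (mem (i :: p)); rewrite ip sp card_ord ltnn.
case/nonuniq_loop => p1 [p2 [p3 [ep p2N0 lp]]].
have p2_gt0 : (0 < size p2)%N by rewrite lt0n size_eq0.
exists (p1 ++ p3); split.
- by rewrite -[ltnRHS]sp ep !size_cat ltn_add2l -[ltnLHS]add0n ltn_add2r.
- by rewrite ep !last_cat lp.
- rewrite ep !walk_weight_cat lp ler_wpM2l ?walk_weight_ge0//.
  rewrite ler_piMl ?walk_weight_ge0// cycA// p2_gt0 -[leqRHS]sp ep !size_cat.
  by rewrite addnCA leq_addr.
Qed.

(** * Max-algebra products, powers and the Kleene star *)

Lemma le_trop_mul {R : realType} {m n p : nat} (A : 'M[R]_(m, n))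
    (B : 'M[R]_(n, p)) i k j :
  A i k * B k j <= trop_mul A B i j.
Proof. by rewrite mxE (le_bigmax _ (fun k => A i k * B k j)). Qed.

Lemma trop_mul_le {R : realType} {m n p : nat} (A : 'M[R]_(m, n))
    (B : 'M[R]_(n, p)) i j c :
  0 <= c -> (forall k, A i k * B k j <= c) -> trop_mul A B i j <= c.
Proof. by move=> c0 ABc; rewrite mxE; apply: bigmax_le. Qed.

Lemma trop_mul_ge0 {R : realType} {m n p : nat} (A : 'M[R]_(m, n))
    (B : 'M[R]_(n, p)) : nonneg_mx (trop_mul A B).
Proof. by move=> i j; rewrite mxE bigmax_ge_id. Qed.

Lemma trop_exp_ge0 {R : realType} {n : nat} (A : 'M[R]_n) k :
  nonneg_mx (trop_exp A k).
Proof.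
case: k => [|k]; last exact: trop_mul_ge0.
by move=> i j; rewrite mxE ler0n.
Qed.

Lemma walk_weight_le_exp {R : realType} {n : nat} (A : 'M[R]_n) i p :
  nonneg_mx A -> walk_weight A i p <= trop_exp A (size p) i (last i p).
Proof.
move=> A0; elim: p i => [|j p IH] i /=; first by rewrite mxE eqxx.
by apply: le_trans (le_trop_mul _ _ _ j _); rewrite ler_wpM2l.
Qed.

Lemma trop_exp_walk {R : realType} {n : nat} (A : 'M[R]_n) k i j :
  nonneg_mx A ->
  trop_exp A k i j = 0 \/
  exists p, [/\ size p = k, last i p = j & trop_exp A k i j = walk_weight A i p].
Proof.
move=> A0; elim: k i => [|k IH] i.
  (* The alternative 0 comes from the off-diagonal entries of [A^0], where no walk of length 0
     exists. *)
  rewrite mxE; have [<-|] := eqVneq; last by left.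
  by right; exists [::].
rewrite mxE.
have [|l _ ->] := eq_bigmax (x := 0) i xpredT
  (fun l => A i l * trop_exp A k l j) isT.
  by move=> l _; rewrite mulr_ge0//; apply: trop_exp_ge0.
have [->|[p [sp lp ->]]] := IH l; first by left; rewrite mulr0.
by right; exists (l :: p); rewrite /= sp.
Qed.

Lemma kleene_starE {R : realType} {n : nat} (A : 'M[R]_n) i j :
  kleene_star A i j = \big[Num.max/0]_(k < n) trop_exp A k i j.
Proof.
by apply: (big_morph (fun B : 'M[R]_n => B i j)) => [B C|]; rewrite mxE.
Qed.

Lemma le_kleene_star {R : realType} {n : nat} (A : 'M[R]_n) k i j :
  (k < n)%N -> trop_exp A k i j <= kleene_star A i j.
Proof.
move=> kn; rewrite kleene_starE.
exact: (le_bigmax _ (fun k : 'I_n => trop_exp A k i j) (Ordinal kn)).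
Qed.

Lemma kleene_star_ge0 {R : realType} {n : nat} (A : 'M[R]_n) :
  nonneg_mx (kleene_star A).
Proof. by move=> i j; rewrite kleene_starE bigmax_ge_id. Qed.

(** If [A^k] attains the entry of the star, the left side is at most an entry of [A^(k+1)]. This is
    again a term of the star unless [k+1 = n]; then a walk of length [n] attains it, and shortening
    brings it back below [n]. *)
Lemma kleene_star_absorb {R : realType} {n : nat} (A : 'M[R]_n) i l j :
  nonneg_mx A -> cycles_le1 A ->
  A i l * kleene_star A l j <= kleene_star A i j.
Proof.
move=> A0 cycA; rewrite [kleene_star A l j]kleene_starE.
have [|k _ ->] := eq_bigmax (x := 0) (Ordinal (leq_ltn_trans (leq0n i) (ltn_ord i)))
  xpredT (fun k : 'I_n => trop_exp A k l j) isT.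
  by move=> k _; apply: trop_exp_ge0.
apply: le_trans (le_trop_mul _ _ _ _ _) _.
rewrite -[trop_mul _ _]/(trop_exp A k.+1).
have := ltn_ord k; rewrite leq_eqVlt => /predU1P[kn|]; last exact: le_kleene_star.
have [->|[p [sp lp ->]]] := trop_exp_walk A k.+1 i j A0.
  exact: kleene_star_ge0.
have [|q [sq lq wq]] := walk_shorten A i p A0 cycA; first by rewrite sp.
apply: le_trans wq (le_trans (walk_weight_le_exp _ _ _ A0) _).
by rewrite lq lp le_kleene_star.
Qed.

(** The diagonal is positive by [A^0], the rest by [A^1], which occurs in the star once two distinct
    indices exist. *)
Lemma kleene_star_pos {R : realType} {n : nat} (A : 'M[R]_n) :
  pos_mx A -> pos_mx (kleene_star A).
Proof.
move=> A0 i j; have n0 := leq_ltn_trans (leq0n i) (ltn_ord i).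
have [<-|ij] := eqVneq i j.
  by apply: lt_le_trans (le_kleene_star A 0 i i n0); rewrite mxE eqxx ltr01.
have n1 : (1 < n)%N.
  rewrite ltnNge; apply: contra_neqN ij => n1.
  have ord_eq0 (k : 'I_n) : k = 0%N :> nat.
    by apply/eqP; rewrite -leqn0 -ltnS (leq_trans (ltn_ord k)).
  by apply: ord_inj; rewrite !ord_eq0.
apply: lt_le_trans (le_kleene_star A 1 i j n1).
by apply: lt_le_trans (le_trop_mul _ _ _ j _); rewrite mxE eqxx mulr1.
Qed.

Lemma trop_mul_kleene_star_absorb {R : realType} {n : nat} (A : 'M[R]_n)
    (u : 'cV[R]_n) i l :
  nonneg_mx A -> cycles_le1 A -> nonneg_mx u ->
  A i l * trop_mul (kleene_star A) u l 0 <= trop_mul (kleene_star A) u i 0.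
Proof.
move=> A0 cycA u0; rewrite [X in _ * X]mxE.
have [|k _ ->] := eq_bigmax (x := 0) i xpredT
  (fun k => kleene_star A l k * u k 0) isT.
  by move=> k _; rewrite mulr_ge0// kleene_star_ge0.
apply: le_trans (le_trop_mul _ _ _ k _).
by rewrite mulrA ler_wpM2r// kleene_star_absorb.
Qed.

(** Iterating [A x <= x] bounds every [A^k x], hence the star applied to [x], by [x]; the term [A^0]
    gives the converse inequality. *)
Lemma kleene_star_fixed {R : realType} {n : nat} (A : 'M[R]_n) (x : 'cV[R]_n) :
  nonneg_mx A -> nonneg_mx x -> (forall i j, A i j * x j 0 <= x i 0) ->
  trop_mul (kleene_star A) x = x.
Proof.
move=> A0 x0 Ax.
have expx k i j : trop_exp A k i j * x j 0 <= x i 0.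
  elim: k i => [|k IH] i.
    by rewrite mxE; have [->|_] := eqVneq; rewrite (mul1r, mul0r).
  have [|l _ E] := eq_bigmax (x := 0) i xpredT
    (fun l => A i l * trop_exp A k l j) isT.
    by move=> l _; rewrite mulr_ge0//; apply: trop_exp_ge0.
  rewrite /= mxE E -mulrA; apply: le_trans (Ax i l).
  by rewrite ler_wpM2l.
apply/matrixP => i j; rewrite (ord1 j).
have n0 := leq_ltn_trans (leq0n i) (ltn_ord i).
apply/le_anti/andP; split.
  apply: trop_mul_le => // k; rewrite kleene_starE.
  have [|l _ ->] := eq_bigmax (x := 0) (Ordinal n0) xpredT
    (fun l : 'I_n => trop_exp A l i k) isT; last exact: expx.
  by move=> l _; apply: trop_exp_ge0.
apply: le_trans (le_trop_mul _ _ _ i _); rewrite ler_peMl//.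
by apply: le_trans (le_kleene_star A 0 i i n0); rewrite mxE eqxx.
Qed.

(** * The approximation error and the spectral radius *)

Lemma log_chebyshev_err_leP {R : realType} {n : nat} (A : 'M[R]_n)
    (x : 'cV[R]_n) c :
  pos_mx x -> 0 <= c ->
  log_chebyshev_err A x <= c <-> forall i j, A i j * x j 0 <= c * x i 0.
Proof.
move=> x0 c0; split=> [errc i j|Axc].
  rewrite -ler_pdivrMr//; apply: le_trans errc.
  apply: le_trans (le_bigmax _ _ i).
  exact: (le_bigmax _ (fun j => A i j * x j 0 / x i 0) j).
(* [c0] bounds the default value 0 of both maxima. *)
by do 2![apply: bigmax_le => // ? _]; rewrite ler_pdivrMr.
Qed.

Lemma le_spectral_radius {R : realType} {n k : nat} (A : 'M[R]_n)
    (f : {ffun 'I_k -> 'I_n}) :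
  nonneg_mx A -> (0 < k <= n)%N ->
  \prod_(l < k) A (f l) (f (ordS l)) <= trop_spectral_radius A ^+ k.
Proof.
move=> A0 /andP[k0 kn].
have P0 : 0 <= \prod_(l < k) A (f l) (f (ordS l)) by apply: prodr_ge0.
have kr0 : k%:R != 0 :> R by rewrite pnatr_eq0 -lt0n.
(* The product is written as the [k]-th power of its [k]-th root, so that only the bases are
   compared. *)
rewrite -[leLHS]powRr1// -[X in _ `^ X <= _](mulVf kr0) powRrM.
rewrite powR_mulrn ?powR_ge0//.
rewrite lerXn2r ?nnegrE ?powR_ge0 ?bigmax_ge_id//.
apply: (bigmax_sup_seq _ k); rewrite ?mem_index_iota ?k0//.
exact: (le_bigmax _ (fun f : {ffun 'I_k -> 'I_n} =>
  (\prod_(l < k) A (f l) (f (ordS l))) `^ k%:R^-1)).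
Qed.

Lemma closed_walk_le {R : realType} {n : nat} (A : 'M[R]_n) i p :
  nonneg_mx A -> (0 < size p <= n)%N -> last i p = i ->
  walk_weight A i p <= trop_spectral_radius A ^+ size p.
Proof.
move=> A0 sp lp.
have := le_spectral_radius A [ffun l : 'I_(size p) => nth i (i :: p) l] A0 sp.
apply: le_trans; rewrite walk_weightE le_eqVlt; apply/orP; left; apply/eqP.
apply: eq_bigr => l _; rewrite !ffunE; congr (A _ _).
rewrite -[val (ordS l)]/(l.+1 %% size p)%N.
(* The last edge wraps around: [ordS] sends its index to 0, and the walk ends at its start by
   [lp]. *)
have := ltn_ord l; rewrite leq_eqVlt => /predU1P[->|lp1]; last by rewrite modn_small.
by rewrite modnn -last_nth lp.
Qed.

Lemma spectral_radius_le_err {R : realType} {n : nat} (A : 'M[R]_n)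
    (x : 'cV[R]_n) :
  nonneg_mx A -> pos_mx x -> trop_spectral_radius A <= log_chebyshev_err A x.
Proof.
move=> A0 x0; set e := log_chebyshev_err A x.
have e0 : 0 <= e by exact: bigmax_ge_id.
have /(log_chebyshev_err_leP A x e x0 e0) Ax : log_chebyshev_err A x <= e by [].
rewrite /trop_spectral_radius big_seq.
apply: bigmax_le => // k; rewrite mem_index_iota => /andP[k0 _].
apply: bigmax_le => // f _.
have P0 : 0 <= \prod_(l < k) A (f l) (f (ordS l)) by apply: prodr_ge0.
have kr0 : k%:R != 0 :> R by rewrite pnatr_eq0 -lt0n.
rewrite -[leRHS]powRr1// -[X in _ <= _ `^ X](mulfV kr0) powRrM powR_mulrn//.
rewrite ge0_ler_powR ?nnegrE ?invr_ge0 ?exprn_ge0//.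
(* Telescoping without quotients: both sides are multiplied by the product of the [x (f l) 0],
   shifted cyclically on the left, and compared factor by factor. *)
have X0 : 0 < \prod_(l < k) x (f l) 0 by apply: prodr_gt0.
rewrite -(ler_pM2r X0).
rewrite [X in _ * X <= _](reindex_inj (@ordS_inj k)) -big_split /=.
rewrite -[X in e ^+ X]card_ord -prodr_const -big_split /=.
by apply: ler_prod => l _; rewrite Ax mulr_ge0// ltW.
Qed.

Theorem theorem4 (R : realType) (n : nat) (hn : (0 < n)%N) (A : 'M[R]_n)
    (hA : pairwise_comparison A) :
  let lambda := trop_spectral_radius A in
  let B := kleene_star (lambda^-1 *: A) in
  score_vectors A =
    [set trop_mul B u | u in [set u : 'cV[R]_n | nonneg_mx u /\ u <> 0]].
Proof.
move=> lambda B.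
have Apos : pos_mx A by move=> i j; case: (hA i j).
have A0 : nonneg_mx A by move=> i j; apply: ltW.
have lam0 : 0 < lambda.
  (* The loop at one vertex has positive weight. *)
  have := closed_walk_le A (Ordinal hn) [:: Ordinal hn] A0 hn erefl.
  by rewrite /= mulr1 expr1; apply: lt_le_trans.
have Mpos : pos_mx (lambda^-1 *: A) by move=> i j; rewrite mxE mulr_gt0 ?invr_gt0.
have M0 : nonneg_mx (lambda^-1 *: A) by move=> i j; apply: ltW.
have cycM : cycles_le1 (lambda^-1 *: A).
  move=> i p sp lp; rewrite walk_weightZ exprVn mulrC.
  by rewrite ler_pdivrMr ?exprn_gt0// mul1r closed_walk_le.
have BuP u : nonneg_mx u -> u <> 0 ->
    pos_mx (trop_mul B u) /\ log_chebyshev_err A (trop_mul B u) <= lambda.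
  move=> u0 uN0.
  have Bu0 : pos_mx (trop_mul B u).
    have [k uk] : exists k, u k 0 != 0.
      apply: contrapT => uE; apply: uN0; apply/matrixP => i j.
      rewrite mxE (ord1 j); apply/eqP/negPn/negP => ui.
      by apply: uE; exists i.
    move=> i j; rewrite (ord1 j); apply: lt_le_trans (le_trop_mul _ _ _ k _).
    by rewrite mulr_gt0 ?kleene_star_pos// lt_neqAle eq_sym uk u0.
  split=> //; apply/log_chebyshev_err_leP => //; first exact: ltW.
  move=> i j; rewrite -ler_pdivrMl// mulrA.
  by have := trop_mul_kleene_star_absorb _ u i j M0 cycM u0; rewrite mxE.
apply/seteqP; split=> [x [x0 xmin]|_ [u [u0 uN0] <-]].
  have xge0 : nonneg_mx x by move=> i j; apply: ltW.
  have xN0 : x <> 0.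
    by move=> xE; have := x0 (Ordinal hn) 0; rewrite xE mxE ltxx.
  have [Bx0 errBx] := BuP x xge0 xN0.
  (* Minimality of [x] is tested against the competitor [B x], so [x] has error at most [lambda];
     then [u = x] is the required preimage. *)
  have /log_chebyshev_err_leP Ax := le_trans (xmin _ Bx0) errBx.
  exists x => //; apply: kleene_star_fixed => // i j.
  by rewrite mxE -mulrA ler_pdivrMl// Ax// ltW.
have [Bu0 errBu] := BuP u u0 uN0.
by split=> // y y0; apply: le_trans errBu (spectral_radius_le_err _ _ A0 y0).
Qed.
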